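(* Let $\mathcal{H}$ be a complex Hilbert space and let $T\in\mathcal{L}(\mathcal{H})$ be a Hermitian operator with closed range. Then: (1) the MP-proper splitting of $T$ converges if and only if $\|P_T-T^2\|<1$; (2) the projection proper splitting of $T$ converges if and only if $\|P_T-T\|<1$.
   Context: $P_T$ is the orthogonal projection onto $\mathcal{R}(T)$ and $T^\dagger$ is the Moore-Penrose inverse of $T$. A proper splitting of a closed range operator $T$ is a decomposition $T=U-V$ with $\mathcal{R}(U)=\mathcal{R}(T)$ and $\mathcal{N}(U)=\mathcal{N}(T)$; it converges if $\rho(U^\dagger V)<1$, where $\rho$ is the spectral radius. For a closed range Hermitian $T$, the MP-proper splitting of $T$ is $T=T^\dagger-W$ (i.e. $W=T^\dagger-T$) and the projection proper splitting of $T$ is $T=P_T-Z$ (i.e. $Z=P_T-T$). *)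

(* Defs.v *)
From HB Require Import structures.
From mathcomp Require Import all_boot all_order all_algebra.
From mathcomp Require Import complex.
From mathcomp Require Import all_classical all_reals all_analysis.
Set Implicit Arguments.
Unset Strict Implicit.
Unset Printing Implicit Defensive.
Import Order.TTheory GRing.Theory Num.Theory.
Import numFieldNormedType.Exports.

Local Open Scope classical_set_scope.
Local Open Scope ring_scope.

(* A complex Hilbert space is a complete normed space over R[i] whose norm
   comes from an inner product, linear on the left and conjugate-linear on the
   right. The zero space is allowed. *)
HB.mixin Record isHilbert (R : realType) H
    of CompleteNormedModule R[i] H := {
  inner : {dot H for Num.conj};
  inner_norm : forall x : H, inner x x = `|x| ^+ 2
}.

#[short(type="hilbertType")]
HB.structure Definition Hilbert (R : realType) :=
  {H of CompleteNormedModule R[i] H & isHilbert R H}.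

Section Operators.
Variables (R : realType) (H : hilbertType R).
Implicit Types (f T U V X : H -> H) (A : set H).

Local Notation "''[' x , y ]" := (@inner R H x y).

(* L(H): for linear maps, boundedness is continuity. *)
Definition bounded_op : set (H -> H) := [set f | linear f /\ continuous f].

Definition hermitian_op T : Prop := forall x y, '[T x, y] = '[x, T y].

Definition null_space T : set H := [set x | T x = 0].

Definition orth_proj A (x : H) : H :=
  xget 0 [set y | A y /\ forall z, A z -> '[x - y, z] = 0].

Definition range_proj T : H -> H := orth_proj (range T).

(* Penrose equations; TX and XT being Hermitian stands for (TX)^* = TX and
   (XT)^* = XT. *)
Definition is_mp_inverse T X : Prop :=
  [/\ T \o X \o T = T, X \o T \o X = X,
      hermitian_op (T \o X) & hermitian_op (X \o T)].

Definition mp_inverse T : H -> H :=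
  xget (fun=> 0) [set X | bounded_op X /\ is_mp_inverse T X].

(* The norm `|x| is an element of R[i] (with zero imaginary part), hence the
   real parts here and in spectral_radius. *)
Definition op_norm f : R :=
  sup [set complex.Re `|f x| | x in [set x : H | `|x| <= 1]].

Definition spectrum f : set R[i] :=
  [set l | ~ exists g, [/\ bounded_op g, cancel (fun x => l *: x - f x) g
                         & cancel g (fun x => l *: x - f x)]].

(* On the zero space the spectrum is empty and the value is sup set0 = 0. *)
Definition spectral_radius f : R :=
  sup [set complex.Re `|l| | l in spectrum f].

Definition proper_splitting T U V : Prop :=
  [/\ bounded_op U, bounded_op V, T = U \- V,
      range U = range T & null_space U = null_space T].

(* The splitting U - V is meant to be proper; rho < 1 involves only U and V. *)
Definition converges U V : Prop := spectral_radius (mp_inverse U \o V) < 1.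

End Operators.

(* Main.v *)
(* In terms of the real norm and the real part of the inner product, H is a
   real Hilbert space. The projection theorem splits H into the range of T and
   its orthogonal complement, which is the kernel of T since T is Hermitian; so
   T restricts to a bijection of its range, whose inverse composed with P_T is
   the Moore-Penrose inverse X. As X is Hermitian, it is bounded by the
   Hellinger-Toeplitz theorem (a gliding hump argument). The iteration operators
   are then X^dagger (X - T) = T (X - T) = P_T - T^2 and
   P_T^dagger (P_T - T) = P_T - T, both Hermitian, and for a bounded Hermitian
   operator A the spectral radius equals the norm: the spectrum lies in the disc
   of radius |A|, and |A| or -|A| belongs to it. *)
Require Import Defs.
From HB Require Import structures.
From mathcomp Require Import all_boot all_order all_algebra.
From mathcomp Require Import complex.
From mathcomp Require Import all_classical all_reals all_analysis.
From mathcomp Require Import ring lra.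
Set Implicit Arguments.
Unset Strict Implicit.
Unset Printing Implicit Defensive.
Import Order.TTheory GRing.Theory Num.Theory.
Import numFieldNormedType.Exports.
Local Open Scope classical_set_scope.
Local Open Scope ring_scope.

(** * The real norm and real inner product underlying [H] *)

Section RealStructure.
Variables (R : realType) (H : hilbertType R).
Implicit Types (x y z : H) (r : R).
Local Open Scope complex_scope.

Definition rnorm x : R := complex.Re `|x|.
Definition rdot x y : R := complex.Re (inner x y).

Lemma rnormE x : `|x| = (rnorm x)%:C.
Proof. by rewrite /rnorm RRe_real// normr_real. Qed.

Lemma rnorm_ge0 x : 0 <= rnorm x.
Proof. by rewrite -ler0c -rnormE normr_ge0. Qed.

Lemma rnorm_eq0 x : rnorm x = 0 -> x = 0.
Proof. by move=> x0; apply/normr0_eq0; rewrite rnormE x0. Qed.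

Lemma rnorm0 : rnorm (0 : H) = 0.
Proof. by rewrite /rnorm normr0. Qed.

Lemma rnorm_gt0 x : x <> 0 -> 0 < rnorm x.
Proof.
by move=> x0; rewrite lt_neqAle rnorm_ge0 andbT eq_sym; apply/eqP => /rnorm_eq0.
Qed.

Lemma rnormD x y : rnorm (x + y) <= rnorm x + rnorm y.
Proof. by have := ler_normD x y; rewrite !rnormE -rmorphD lecR. Qed.

Lemma rnormN x : rnorm (- x) = rnorm x.
Proof. by rewrite /rnorm normrN. Qed.

Lemma rnormB x y : rnorm (x - y) = rnorm (y - x).
Proof. by rewrite -rnormN opprB. Qed.

Lemma rnormZ (c : R[i]) x : rnorm (c *: x) = complex.Re `|c| * rnorm x.
Proof.
have cE : `|c| = (complex.Re `|c|)%:C by rewrite RRe_real// normr_real.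
by apply: (@complexI R); rewrite rmorphM /= -cE -!rnormE normrZ.
Qed.

Lemma Re_norm_real r : complex.Re `|r%:C| = `|r|.
Proof. by rewrite normc_def /= expr0n addr0 sqrtr_sqr. Qed.

Lemma rnormZr r x : rnorm (r%:C *: x) = `|r| * rnorm x.
Proof. by rewrite rnormZ Re_norm_real. Qed.

Lemma ReD (u v : R[i]) : complex.Re (u + v) = complex.Re u + complex.Re v.
Proof. by case: u v => ? ? [? ?]. Qed.

Lemma ReN (u : R[i]) : complex.Re (- u) = - complex.Re u.
Proof. by case: u. Qed.

Lemma rdotC x y : rdot x y = rdot y x.
Proof.
rewrite /rdot hermC /= expr0 mul1r.
by case: (inner y x).
Qed.

Lemma rdotDl x y z : rdot (x + y) z = rdot x z + rdot y z.
Proof. by rewrite /rdot linearDl ReD. Qed.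

Lemma rdotNl x z : rdot (- x) z = - rdot x z.
Proof. by rewrite /rdot linearNl ReN. Qed.

Lemma rdotBl x y z : rdot (x - y) z = rdot x z - rdot y z.
Proof. by rewrite rdotDl rdotNl. Qed.

Lemma rdotZl r x z : rdot (r%:C *: x) z = r * rdot x z.
Proof.
rewrite /rdot linearZl_LR /= -[GRing.mul _ _]/(r%:C * inner x z).
by case: (inner x z) => a b /=; rewrite mul0r subr0.
Qed.

Lemma rdotDr x y z : rdot z (x + y) = rdot z x + rdot z y.
Proof. by rewrite !(rdotC z) rdotDl. Qed.

Lemma rdotBr x y z : rdot z (x - y) = rdot z x - rdot z y.
Proof. by rewrite !(rdotC z) rdotBl. Qed.

Lemma rdotZr r x z : rdot z (r%:C *: x) = r * rdot z x.
Proof. by rewrite !(rdotC z) rdotZl. Qed.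

Lemma rdotxx x : rdot x x = rnorm x ^+ 2.
Proof. by rewrite /rdot inner_norm rnormE -rmorphXn. Qed.

Lemma rnormBE x y :
  rnorm (x - y) ^+ 2 = rnorm x ^+ 2 - 2 * rdot x y + rnorm y ^+ 2.
Proof. rewrite -!rdotxx rdotBl !rdotBr (rdotC y x); ring. Qed.

(** With [c := inner x y], conjugate-linearity turns [inner x (c *: y)] into the squared modulus of
    [inner x y], which is its own real part. *)
Lemma inner_eq0 x y : (forall c : R[i], rdot x (c *: y) = 0) -> inner x y = 0.
Proof.
move=> xy0; apply/eqP; rewrite -normr_eq0 -sqrf_eq0 normCK; apply/eqP.
have := xy0 (inner x y); rewrite /rdot linearZr_LR /= mulrC -normCK => h.
rewrite -[LHS]RRe_real ?h// normCK ger0_real// mul_conjC_ge0.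
Qed.

Lemma rdot_le x y : rdot x y <= rnorm x * rnorm y.
Proof.
have [x0|/rnorm_gt0 x0] := pselect (x = 0).
  have : rdot (x - x) y = 0 by rewrite rdotBl subrr.
  by rewrite subrr x0 rnorm0 mul0r => ->.
have [y0|/rnorm_gt0 y0] := pselect (y = 0).
  have : rdot x (y - y) = 0 by rewrite rdotBr subrr.
  by rewrite subrr y0 rnorm0 mulr0 => ->.
(* Cauchy-Schwarz: with [p = rnorm x * rnorm y], this square expands to [2 * p * (p - rdot x y)],
   and [p] is positive. *)
have := sqr_ge0 (rnorm ((rnorm y)%:C *: x - (rnorm x)%:C *: y)).
rewrite rnormBE rdotZl rdotZr !rnormZr !ger0_norm ?rnorm_ge0// => h.
have xy0 : 0 < rnorm x * rnorm y by rewrite mulr_gt0.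
rewrite -(ler_pM2l xy0); nra.
Qed.

End RealStructure.

(** * Convergence, completeness and continuity in terms of the real norm *)

Section Metric.
Variables (R : realType) (H : hilbertType R).
Implicit Types (x y z l : H) (u : nat -> H) (f : H -> H) (A : set H).
Local Open Scope complex_scope.

Definition rconverges u l :=
  forall e : R, 0 < e -> exists N, forall n, (N <= n)%N -> rnorm (u n - l) < e.

Definition rcauchy u :=
  forall e : R, 0 < e ->
    exists N, forall m n, (N <= m)%N -> (N <= n)%N -> rnorm (u m - u n) < e.

Definition seq_closed A :=
  forall u l, (forall n, A (u n)) -> rconverges u l -> A l.

(** Positive elements of [R[i]] have zero imaginary part, so the radii in the topology of [H] are
    real numbers. *)
Lemma pos_complexP (e : R[i]) : 0 < e -> exists2 r : R, 0 < r & e = r%:C.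
Proof.
move=> e0; exists (complex.Re e); last by rewrite RRe_real// gtr0_real.
by rewrite -ltcR RRe_real// gtr0_real.
Qed.

Lemma rconvergesP u l : rconverges u l <-> u @ \oo --> l.
Proof.
split=> [ul|/cvgrPdist_lt ul r r0].
  apply/cvgrPdist_lt => _ /pos_complexP[r r0 ->].
  have [N Nul] := ul r r0; exists N => // n /= Nn.
  by rewrite rnormE ltcR rnormB; exact: Nul.
have [|N _ Nul] := ul r%:C; first by rewrite ltcR.
exists N => n Nn; rewrite rnormB -ltcR -rnormE; exact: Nul.
Qed.

Lemma rcauchy_cvg u : rcauchy u -> exists l, rconverges u l.
Proof.
move=> cu; suff /cvg_ex[l /rconvergesP ul] : cvg (u @ \oo) by exists l.
apply/cauchy_cvgP/cauchy_ballP => _ /pos_complexP[r r0 ->].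
have [N Nu] := cu r r0.
pose B : set H := u @` [set n | (N <= n)%N].
exists (B, B) => /=; first by split; exists N => // n Nn; exists n.
move=> [_ _] [/= [m Nm <-] [n Nn <-]].
by rewrite -ball_normE /ball_ /= rnormE ltcR; exact: Nu.
Qed.

Lemma closed_seq_closed A : closed A -> seq_closed A.
Proof.
move=> cA u l Au /rconvergesP ul.
by apply: (closed_cvg A cA _ _ ul); exact: nearW.
Qed.

Lemma continuous_rbounded f : linear f ->
  continuous f <-> exists2 C : R, 0 < C & forall x, rnorm (f x) <= C * rnorm x.
Proof.
move=> lf.
pose g : {linear H -> H} := HB.pack f (GRing.isLinear.Build _ _ _ _ _ lf).
rewrite -[X in continuous X]/(g : H -> H) -linear_bounded_continuous.
rewrite linear_boundedP; split=> [/pinfty_ex_gt0[_ /pos_complexP[r r0 ->] rf]|].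
  by exists r => // x; have := rf x; rewrite !rnormE -rmorphM lecR.
move=> [r r0 rf]; exists r%:C; split=> [|s rs x].
  by rewrite ger0_real// ler0c ltW.
apply: le_trans (ler_wpM2r (normr_ge0 x) (ltW rs)).
by rewrite !rnormE -rmorphM lecR; exact: rf.
Qed.

End Metric.

(** * Linearity rules for functions not bundled as linear maps *)

Section LinearMaps.
Variables (R : realType) (H : hilbertType R) (f : H -> H) (lf : linear f).

Let g : {linear H -> H} := HB.pack f (GRing.isLinear.Build _ _ _ _ _ lf).

Lemma linear_map0 : f 0 = 0.
Proof. exact: (linear0 g). Qed.

Lemma linear_mapB x y : f (x - y) = f x - f y.
Proof. exact: (linearB g). Qed.

Lemma linear_mapZ c x : f (c *: x) = c *: f x.
Proof. exact: (linearZ_LR g). Qed.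

End LinearMaps.

(** * Projection theorem *)

Section Projection.
Variables (R : realType) (H : hilbertType R).
Implicit Types (x y z : H) (A : set H).
Local Open Scope complex_scope.

Definition is_subspace A :=
  A 0 /\ forall (c : R[i]) x y, A x -> A y -> A (c *: x + y).

Lemma subspaceD A x y : is_subspace A -> A x -> A y -> A (x + y).
Proof. by move=> [_ lA] Ax Ay; rewrite -[x]scale1r; exact: lA. Qed.

Lemma subspaceZ A (c : R[i]) x : is_subspace A -> A x -> A (c *: x).
Proof. by move=> [A0 lA] Ax; rewrite -[_ *: _]addr0; exact: lA. Qed.

Lemma range_subspace (f : H -> H) : linear f -> is_subspace (range f).
Proof.
move=> lf; split; first by exists 0 => //; exact: linear_map0.
by move=> c _ _ [x _ <-] [y _ <-]; exists (c *: x + y) => //; exact: lf.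
Qed.

(** Apollonius' identity at the midpoint of [a] and [b], which lies in [A] and so has squared
    distance at least [d] from [x]. It makes minimizing sequences Cauchy. *)
Lemma subspace_apollonius A (d : R) x a b : is_subspace A ->
    (forall z, A z -> d <= rnorm (x - z) ^+ 2) -> A a -> A b ->
  rnorm (a - b) ^+ 2 <=
    2 * (rnorm (x - a) ^+ 2 - d) + 2 * (rnorm (x - b) ^+ 2 - d).
Proof.
move=> sA dA Aa Ab.
have := dA _ (subspaceZ (2^-1)%:C sA (subspaceD sA Aa Ab)).
rewrite -!rdotxx !rdotBl !rdotBr !rdotZl !rdotZr !rdotDl !rdotDr.
rewrite (rdotC a x) (rdotC b x) (rdotC b a); lra.
Qed.

Lemma nearest_point A x : is_subspace A -> seq_closed A ->
  exists2 p, A p & forall z, A z -> rnorm (x - p) <= rnorm (x - z).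
Proof.
move=> sA cA; have [A0 _] := sA.
pose D := [set rnorm (x - z) ^+ 2 | z in A]; pose d := inf D.
have hD : has_inf D.
  split; first by exists (rnorm (x - 0) ^+ 2); exists 0.
  by exists 0 => _ [z _ <-]; rewrite sqr_ge0.
have dA z : A z -> d <= rnorm (x - z) ^+ 2.
  by move=> Az; apply: ge_inf; [exact: hD.2|exists z].
have d0 : 0 <= d.
  by apply: lb_le_inf; [exact: hD.1|move=> _ [z _ <-]; rewrite sqr_ge0].
have /choice[u uP] : forall n, exists z,
    A z /\ rnorm (x - z) ^+ 2 < d + n.+1%:R^-1.
  move=> n; have n0 : 0 < n.+1%:R^-1 :> R by rewrite invr_gt0.
  by have [_ [z Az <-] zd] := inf_adherent n0 hD; exists z.
have [p up] : exists p, rconverges u p.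
  apply: rcauchy_cvg => e e0.
  (* Two excesses over [d] below [e ^+ 2 / 4], each with weight 2, add up to less than [e ^+ 2]. *)
  have e20 : 0 < e ^+ 2 / 4 by rewrite divr_gt0 ?exprn_gt0.
  have [N _ NP] := near_infty_natSinv_lt (PosNum e20).
  exists N => m n Nm Nn.
  have := subspace_apollonius sA dA (uP m).1 (uP n).1.
  have := (uP m).2; have := (uP n).2; have := NP m Nm; have := NP n Nn => /=.
  move=> h1 h2 h3 h4 h5.
  suff : rnorm (u m - u n) ^+ 2 < e ^+ 2.
    by rewrite ltr_sqr ?nnegrE ?rnorm_ge0 ?ltW.
  move: (n.+1%:R^-1) (m.+1%:R^-1) h1 h2 h3 h4 => a b h1 h2 h3 h4; lra.
exists p => [|z Az]; first by apply: cA up => n; exact: (uP n).1.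
suff pd : rnorm (x - p) ^+ 2 <= d.
  by rewrite -ler_sqr ?nnegrE ?rnorm_ge0// (le_trans pd)// dA.
rewrite leNgt; apply/negP; set s := rnorm (x - p) => sd.
have s0 : 0 <= s := rnorm_ge0 _.
(* From [s <= t + e], [t ^+ 2 < d + e], [t <= s + 1] and [e <= 1] follows
   [s ^+ 2 < d + (4 + 2 * s) * e]; this [e] makes the last term at most half of [s ^+ 2 - d]. *)
pose e := Num.min 1 ((s ^+ 2 - d) / (2 * (4 + 2 * s))).
have e0 : 0 < e by rewrite lt_min ltr01 divr_gt0 ?subr_gt0//; lra.
have e1 : e <= 1 by rewrite ge_min lexx.
have es : e * (2 * (4 + 2 * s)) <= s ^+ 2 - d.
  by rewrite -ler_pdivlMr ?ge_min ?lexx ?orbT//; lra.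
have [N NP] := up _ e0; have [M _ MP] := near_infty_natSinv_lt (PosNum e0).
pose n := maxn N M.
have := NP n (leq_maxl _ _); have := MP n (leq_maxr _ _) => /=.
have := (uP n).2; have := rnormD (x - u n) (u n - p).
have := rnormD (x - p) (p - u n); have := rnorm_ge0 (x - u n).
rewrite !subrKA (rnormB p) -/s.
set t := rnorm (x - u n); set h := rnorm (u n - p); set k := n.+1%:R^-1.
move: t h k => t h k t0 ts st tk ke he.
have : s ^+ 2 <= (t + e) ^+ 2 by rewrite ler_sqr ?nnegrE; lra.
have : t * e <= (s + 1) * e by rewrite ler_pM2r//; lra.
nra.
Qed.

Theorem orthogonal_decomposition A x : is_subspace A -> seq_closed A ->
  exists2 p, A p & forall z, A z -> inner (x - p) z = 0.
Proof.
move=> sA cA; have [p Ap pmin] := nearest_point x sA cA.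
exists p => // z Az; apply: inner_eq0 => c.
have := subspaceZ c sA Az; move: (c *: z) => {Az c}z Az.
pose w := rnorm z ^+ 2; have w0 : 0 <= w by exact: sqr_ge0.
(* Moving from [p] by [r] times [z] changes the squared distance by [- r ^+ 2 * (w + 2)], so
   minimality forces [r = 0]. The [+ 1] keeps the denominator nonzero when [z = 0]. *)
pose r := rdot (x - p) z / (w + 1).
have rE : rdot (x - p) z = r * (w + 1) by rewrite divfK//; lra.
have := pmin _ (subspaceD sA (subspaceZ r%:C sA Az) Ap).
have -> : x - (r%:C *: z + p) = x - p - r%:C *: z.
  by rewrite opprD addrCA addrC.
rewrite -ler_sqr ?nnegrE ?rnorm_ge0// [leRHS]rnormBE rdotZr rnormZr.
rewrite exprMn -/w real_normK ?num_real// rE => h.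
have r0 : r = 0 by nra.
by rewrite r0 mul0r.
Qed.

End Projection.

(** * Hellinger-Toeplitz theorem *)

Section HellingerToeplitz.
Variables (R : realType) (H : hilbertType R).
Implicit Types (x y z l : H) (u : nat -> H) (f : H -> H).
Local Open Scope complex_scope.

Lemma hermitian_rdot f x y : hermitian_op f -> rdot (f x) y = rdot x (f y).
Proof. by move=> hf; rewrite /rdot hf. Qed.

Lemma rdot_norm_le x y : `|rdot x y| <= rnorm x * rnorm y.
Proof.
by rewrite ler_norml rdot_le andbT lerNl -rdotNl -(rnormN x) rdot_le.
Qed.

Lemma rconverges_rnorm_le u l a (c : R) N : rconverges u l ->
  (forall n, (N <= n)%N -> rnorm (u n - a) <= c) -> rnorm (l - a) <= c.
Proof.
move=> ul uc; apply/ler_addgt0Pr => e e0; have [M ulM] := ul e e0.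
have := uc _ (leq_maxl N M); have := ulM _ (leq_maxr N M).
have := rnormD (l - u (maxn N M)) (u (maxn N M) - a).
rewrite subrKA rnormB; lra.
Qed.

Lemma third_pow_small (e : R) : 0 < e ->
  exists N, forall n, (N <= n)%N -> 3^-1 ^+ n < e.
Proof.
move=> e0; have [N _ NP] := near_infty_natSinv_lt (PosNum e0).
exists N => n Nn; apply: le_lt_trans (NP n Nn).
by rewrite exprVn lef_pV2 ?posrE ?exprn_gt0// -natrX ler_nat ltn_expl.
Qed.

(** The factor [3 / 2] sums the geometric series of ratio one third. The tail after step [n] is then
    half the size of that step, which is what the gliding hump needs. *)
Lemma third_pow_steps_cvg u :
    (forall n, rnorm (u n.+1 - u n) <= 3^-1 ^+ n) ->
  exists l, rconverges u l /\
    forall n, rnorm (l - u n) <= 3 / 2 * 3^-1 ^+ n.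
Proof.
move=> ustep.
have far n k :
    rnorm (u (n + k)%N - u n) <= 3 / 2 * (3^-1 ^+ n - 3^-1 ^+ (n + k)).
  elim: k => [|k IH]; first by rewrite addn0 !subrr rnorm0 mulr0.
  have := rnormD (u (n + k).+1 - u (n + k)%N) (u (n + k)%N - u n).
  have := ustep (n + k)%N.
  rewrite subrKA addnS exprS; lra.
have near n m : (n <= m)%N -> rnorm (u m - u n) <= 3 / 2 * 3^-1 ^+ n.
  move=> /subnKC <-; apply: le_trans (far _ _) _.
  have : 0 <= 3^-1 ^+ (n + (m - n)) :> R by rewrite exprn_ge0.
  lra.
have [|l ul] := @rcauchy_cvg _ _ u.
  move=> e e0; have e30 : 0 < e / 3 by rewrite divr_gt0.
  have [N NP] := third_pow_small e30; exists N => m n Nm Nn.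
  have := NP N (leqnn N); have := near _ _ Nm; have := near _ _ Nn.
  have := rnormD (u m - u N) (u N - u n).
  rewrite subrKA (rnormB (u N)); lra.
exists l; split=> // n; exact: (rconverges_rnorm_le ul (near n)).
Qed.

(* Gliding hump: if [f] were unbounded, the sum of tiny multiples of the large
   vectors [f (v n)], with signs chosen so that they never cancel, would be a
   point [l] with [rdot (f l) (v n) = rdot l (f (v n))] too large. *)
Theorem hermitian_linear_rbounded f : linear f -> hermitian_op f ->
  exists2 C : R, 0 < C & forall x, rnorm (f x) <= C * rnorm x.
Proof.
move=> lf hf; apply: contrapT => nb.
have /choice[v vP] : forall n, exists x,
    2 * n.+1%:R * 3 ^+ n * rnorm x < rnorm (f x).
  move=> n; apply: contrapT => nx; apply: nb.
  exists (2 * n.+1%:R * 3 ^+ n) => [|x]; first by rewrite !mulr_gt0 ?exprn_gt0.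
  by rewrite leNgt; apply/negP => h; apply: nx; exists x.
pose b n := f (v n).
have b0 n : 0 < rnorm (b n).
  apply: le_lt_trans (vP n).
  by rewrite !mulr_ge0 ?rnorm_ge0 ?exprn_ge0.
(* The sign of the new term agrees with that of [rdot y (b n)], so their absolute values add. *)
pose s y n : R := if 0 <= rdot y (b n) then 1 else -1.
pose fix u n := if n is m.+1
  then (s (u m) m * (3^-1 ^+ m / rnorm (b m)))%:C *: b m + u m else 0.
have q0 n : 0 < 3^-1 ^+ n :> R by rewrite exprn_gt0.
have [|l [_ lu]] := @third_pow_steps_cvg u.
  move=> n /=; rewrite addrK rnormZr normrM.
  have -> : `|s (u n) n| = 1 by rewrite /s; case: ifP; rewrite ?normrN normr1.
  by rewrite mul1r ger0_norm ?divfK ?gt_eqF// ltW// divr_gt0.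
have hump n : 3^-1 ^+ n * rnorm (b n) <= `|rdot (u n.+1) (b n)|.
  rewrite /= rdotDl rdotZl rdotxx.
  have -> : s (u n) n * (3^-1 ^+ n / rnorm (b n)) * rnorm (b n) ^+ 2 =
            s (u n) n * (3^-1 ^+ n * rnorm (b n)).
    by rewrite expr2 !mulrA divfK// gt_eqF.
  have : 0 < 3^-1 ^+ n * rnorm (b n) by rewrite mulr_gt0.
  rewrite /s; case: ifPn => [h|]; last rewrite -ltNge => h.
    by rewrite mul1r => ?; rewrite ger0_norm; lra.
  by rewrite mulN1r => ?; rewrite ltr0_norm; lra.
(* This index satisfies [rnorm (f l) < n.+1%:R], against the factor [n.+1%:R] in [vP]. *)
pose n := Num.truncn (rnorm (f l)).
have := truncnS_gt (rnorm (f l)); rewrite -/n => nl.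
have := hump n; have := vP n; rewrite -/(b n) => bv hn.
have := rdot_norm_le (l - u n.+1) (b n); rewrite rdotBl => tl.
have := lerB_dist (rdot (u n.+1) (b n)) (rdot l (b n)).
rewrite distrC => ul.
have := rdot_norm_le (f l) (v n); rewrite hermitian_rdot// -/(b n) => fl.
have := ler_wpM2r (rnorm_ge0 (b n)) (lu n.+1); rewrite exprS => lb.
(* The tail of [l] beyond [u n.+1] cancels at most half of the hump. *)
have qb : 3^-1 ^+ n * rnorm (b n) <= 2 * (rnorm (f l) * rnorm (v n)) by lra.
have : 3^-1 ^+ n * (2 * n.+1%:R * 3 ^+ n * rnorm (v n)) <
       3^-1 ^+ n * rnorm (b n) by rewrite ltr_pM2l.
rewrite exprVn mulrCA -!mulrA.
rewrite mulVKf ?expf_neq0 ?pnatr_eq0//.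
have := ler_wpM2r (rnorm_ge0 (v n)) (ltW nl); move: qb; rewrite exprVn; lra.
Qed.

End HellingerToeplitz.

(** * Orthogonal projections and Moore-Penrose inverses *)

Section HermitianOperators.
Variables (R : realType) (H : hilbertType R).
Implicit Types (x y z : H) (f g T X Y : H -> H) (A : set H).
Local Notation "''[' x , y ]" := (@inner R H x y).

Lemma innerBl x y z : '[x - y, z] = '[x, z] - '[y, z].
Proof. by rewrite linearBl. Qed.

Lemma innerBr x y z : '[x, y - z] = '[x, y] - '[x, z].
Proof. by rewrite linearBr. Qed.

Lemma inner_nondegenerate x : (forall y, '[x, y] = 0) -> x = 0.
Proof.
by move=> x0; apply: rnorm_eq0; apply/eqP; rewrite -sqrf_eq0 -rdotxx /rdot x0.
Qed.

Lemma inner_sym0 x y : '[x, y] = 0 -> '[y, x] = 0.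
Proof. by move=> xy; rewrite hermC /= xy rmorph0 mulr0. Qed.

Lemma hermitian_bounded_op f : linear f -> hermitian_op f -> bounded_op f.
Proof.
move=> lf hf; split=> //.
exact/continuous_rbounded/hermitian_linear_rbounded.
Qed.

Lemma linear_sub_fun f g : linear f -> linear g -> linear (f \- g).
Proof.
by move=> lf lg c x y /=; rewrite lf lg scalerBr opprD addrACA.
Qed.

Lemma linear_comp_fun f g : linear f -> linear g -> linear (f \o g).
Proof. by move=> lf lg c x y /=; rewrite lg lf. Qed.

Lemma hermitian_sub_fun f g :
  hermitian_op f -> hermitian_op g -> hermitian_op (f \- g).
Proof. by move=> hf hg x y /=; rewrite innerBl innerBr hf hg. Qed.

Section OrthogonalProjection.
Variables (A : set H) (sA : is_subspace A) (cA : seq_closed A).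
Let P := orth_proj A.

Lemma orth_projP x : A (P x) /\ forall z, A z -> '[x - P x, z] = 0.
Proof.
have [p Ap xp] := orthogonal_decomposition x sA cA.
exact: (@xgetPex _ 0 [set y | A y /\ forall z, A z -> '[x - y, z] = 0]
          (ex_intro _ p (conj Ap xp))).
Qed.

(** The vector [P x - p] lies in [A] and is a difference of two vectors orthogonal to [A], hence is
    orthogonal to itself. *)
Lemma orth_proj_eq x p : A p -> (forall z, A z -> '[x - p, z] = 0) -> P x = p.
Proof.
move=> Ap xp; have [AP xP] := orth_projP x.
have AB : A (P x - p) by rewrite addrC -scaleN1r; apply: sA.2.
apply/subr0_eq/rnorm_eq0/eqP; rewrite -sqrf_eq0 -rdotxx /rdot.
have {1}-> : P x - p = (x - p) - (x - P x) by rewrite opprB [RHS]addrC subrKA.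
by rewrite innerBl /= xp// xP// subr0.
Qed.

Lemma orth_proj_id x : A x -> P x = x.
Proof. by move=> Ax; apply: orth_proj_eq => // z _; rewrite subrr linear0l. Qed.

Lemma orth_proj_linear : linear P.
Proof.
move=> c x y; have [Ax xP] := orth_projP x; have [Ay yP] := orth_projP y.
apply: orth_proj_eq => [|z Az]; first exact: sA.2.
rewrite opprD addrACA -scalerBr linearDl linearZl_LR /= xP// yP//.
by rewrite mulr0 addr0.
Qed.

Lemma orth_proj_hermitian : hermitian_op P.
Proof.
move=> x y; have [Ax xP] := orth_projP x; have [Ay yP] := orth_projP y.
have : '[P x, y - P y] = '[x - P x, P y].
  by rewrite xP// inner_sym0// yP.
by rewrite innerBl innerBr => /eqP; rewrite subr_eq subrK => /eqP.
Qed.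

End OrthogonalProjection.

Lemma mp_inverse_sym T X : is_mp_inverse T X -> is_mp_inverse X T.
Proof. by case. Qed.

(** Since [TX = (TY)(TX)], moving both Hermitian factors across the inner product gives
    [(TX)(TY) = TY], so [TX = TY]; likewise [XT = YT]. Then [X = XTX = YTY = Y]. *)
Lemma mp_inverse_unique T X Y :
  is_mp_inverse T X -> is_mp_inverse T Y -> X = Y.
Proof.
move=> [TXT XTX hTX hXT] [TYT YTY hTY hYT].
have /= eTXT x : T (X (T x)) = T x := congr1 (@^~ x) TXT.
have /= eTYT x : T (Y (T x)) = T x := congr1 (@^~ x) TYT.
have eTX x : T (X x) = T (Y x).
  apply/subr0_eq/inner_nondegenerate => y; rewrite innerBl /=.
  rewrite -{1}(eTYT (X x)) (hTY _ y) (hTX x) /= eTXT -(hTY x) subrr //.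
have eXT x : X (T x) = Y (T x).
  apply/subr0_eq/inner_nondegenerate => y; rewrite innerBl /=.
  by rewrite -{1}(eTYT x) (hXT _ y) (hYT x) /= eTXT -(hYT x) /= subrr.
apply/funext => x.
by rewrite -[LHS](congr1 (@^~ x) XTX) -[RHS](congr1 (@^~ x) YTY) /= eTX eXT.
Qed.

Lemma mp_inverse_eq T X : bounded_op X -> is_mp_inverse T X -> mp_inverse T = X.
Proof.
move=> bX TX; have [_ TY] := @xgetPex _ (fun=> 0)
  [set X | bounded_op X /\ is_mp_inverse T X] (ex_intro _ X (conj bX TX)).
exact: mp_inverse_unique TY TX.
Qed.

Section ClosedRange.
Variables (T : H -> H) (lT : linear T) (hT : hermitian_op T).
Hypothesis cT : seq_closed (range T).
Let P := range_proj T.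

Let P_id x : range T x -> P x = x.
Proof. exact/orth_proj_id/cT/range_subspace. Qed.

Let P_range x : range T (P x).
Proof. by have [] := orth_projP (range_subspace lT) cT x. Qed.

Lemma range_proj_linear : linear P.
Proof. exact/orth_proj_linear/cT/range_subspace. Qed.

Lemma range_proj_hermitian : hermitian_op P.
Proof. exact/orth_proj_hermitian/cT/range_subspace. Qed.

Lemma range_projl x : P (T x) = T x.
Proof. by apply: P_id; exists x. Qed.

Lemma range_projr x : T (P x) = T x.
Proof.
apply/subr0_eq/inner_nondegenerate => y.
rewrite -(linear_mapB lT) hT; apply: inner_sym0.
rewrite -opprB -scaleN1r linearZr_LR /= inner_sym0 ?mulr0//.
by apply (orth_projP (range_subspace lT) cT x).2; exists y.
Qed.

Lemma range_proj_idem x : P (P x) = P x.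
Proof. exact/P_id/P_range. Qed.

(** The range of [T] meets its kernel only in 0: the squared norm of [T (a - b)] is the inner
    product of [a - b] with [T (T (a - b))]. *)
Lemma hermitian_inj_range x y : range T x -> range T y -> T x = T y -> x = y.
Proof.
move=> [a _ <-] [b _ <-] /eqP; rewrite -subr_eq0 -(linear_mapB lT) => /eqP Tab.
apply/subr0_eq; rewrite -(linear_mapB lT); apply: rnorm_eq0; apply/eqP.
by rewrite -sqrf_eq0 -rdotxx /rdot hT (linear_mapB lT) Tab linear0r.
Qed.

Lemma mp_inverse_exists : exists X, [/\ linear X, hermitian_op X,
  range X `<=` range T, (forall x, T (X x) = P x) & forall x, X (T x) = P x].
Proof.
have /choice[X XP] : forall x, exists z, range T z /\ T z = P x.
  move=> x; have [w _ wP] := P_range x.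
  (* Projecting a preimage [w] puts it in the range of [T] without changing its image. *)
  by exists (P w); split; [exact: P_range|rewrite range_projr].
have XT x : X (T x) = P x.
  apply: hermitian_inj_range => //; first exact: (XP _).1.
  by rewrite (XP _).2 range_projl range_projr.
exists X; split=> // [c x y|x y|_ [x _ <-]|x]; last 2 first.
- exact: (XP x).1.
- exact: (XP x).2.
- apply: hermitian_inj_range; first exact: (XP _).1.
    by apply: (range_subspace lT).2; exact: (XP _).1.
  by rewrite lT !(XP _).2 range_proj_linear.
(* [X] is Hermitian because [T] and [P] are: write [X x = P (X x)], move [P] onto [y], replace [P y]
   by [T (X y)], move [T] back, and undo. *)
- rewrite -(P_id (XP x).1) range_proj_hermitian -(XP y).2 -hT (XP x).2.
  by rewrite range_proj_hermitian (P_id (XP y).1).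
Qed.

End ClosedRange.
End HermitianOperators.

(** * Spectral radius of Hermitian operators *)

Section SpectralRadius.
Variables (R : realType) (H : hilbertType R).
Implicit Types (x y z : H) (f g : H -> H).
Local Notation "''[' x , y ]" := (@inner R H x y).
Local Open Scope complex_scope.

Section OperatorNorm.
Variables (f : H -> H) (bf : bounded_op f).

Let has_sup_op_norm :
  has_sup [set complex.Re `|f x| | x in [set x : H | `|x| <= 1]].
Proof.
have [lf cf] := bf; split.
  by exists (rnorm (f 0)); exists 0 => //=; rewrite normr0.
have [C C0 fC] := (continuous_rbounded lf).1 cf.
exists C => _ [x /= x1 <-]; apply: le_trans (fC x) _.
by rewrite ger_pMr//; rewrite rnormE -(rmorph1 (real_complex R)) lecR in x1.
Qed.

Lemma op_norm_ge0 : 0 <= op_norm f.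
Proof.
apply: le_trans (rnorm_ge0 (f 0)) _; apply: sup_ubound has_sup_op_norm.2 _ _.
by exists 0 => //=; rewrite normr0.
Qed.

Lemma rnorm_le_op_norm x : rnorm (f x) <= op_norm f * rnorm x.
Proof.
have [->|/rnorm_gt0 x0] := pselect (x = 0).
  by rewrite (linear_map0 bf.1) !rnorm0 mulr0.
rewrite -ler_pdivrMr//.
have -> : rnorm (f x) / rnorm x = rnorm (f ((rnorm x)^-1%:C *: x)).
  by rewrite (linear_mapZ bf.1) rnormZr ger0_norm ?invr_ge0 ?ltW// mulrC.
apply: sup_ubound has_sup_op_norm.2 _ _; exists ((rnorm x)^-1%:C *: x) => //=.
rewrite rnormE -(rmorph1 (real_complex R)) lecR rnormZr.
by rewrite ger0_norm ?invr_ge0 ?rnorm_ge0// mulVf ?gt_eqF.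
Qed.

Lemma op_norm_le (c : R) : 0 <= c ->
  (forall x, rnorm (f x) <= c * rnorm x) -> op_norm f <= c.
Proof.
move=> c0 fc; apply: ge_sup; first exact: has_sup_op_norm.1.
move=> _ [x /= x1 <-]; apply: le_trans (fc x) _.
by rewrite ler_piMr//; rewrite rnormE -(rmorph1 (real_complex R)) lecR in x1.
Qed.

End OperatorNorm.

Section Resolvent.
Variables (f : H -> H) (bf : bounded_op f) (hf : hermitian_op f).
Let a := op_norm f.

Let lf : linear f. Proof. exact: bf.1. Qed.

Lemma shift_linear (c : R[i]) : linear (fun x => c *: x - f x).
Proof.
move=> d x y; rewrite lf scalerDr scalerBr opprD addrACA !scalerA.
by rewrite (mulrC c).
Qed.

Lemma shift_lower_bound (c : R[i]) x :
  (complex.Re `|c| - a) * rnorm x <= rnorm (c *: x - f x).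
Proof.
have := rnormD (c *: x - f x) (f x); rewrite subrK rnormZ.
by have := rnorm_le_op_norm bf x; rewrite -/a; lra.
Qed.

(** If the modulus of [c] exceeds [a], then [g = c - f] is bounded below, hence injective with
    closed range; the range is all of [H] because its orthogonal complement is zero. The inverse is
    bounded by [k^-1]. *)
Lemma spectrum_norm_le (c : R[i]) : spectrum f c -> complex.Re `|c| <= a.
Proof.
move=> sc; rewrite leNgt; apply/negP => ac; apply: sc.
pose g x := c *: x - f x; have lg : linear g := shift_linear c.
pose k := complex.Re `|c| - a; have k0 : 0 < k by rewrite subr_gt0.
have gk x : k * rnorm x <= rnorm (g x) by exact: shift_lower_bound.
have [C C0 gC] : exists2 C : R, 0 < C & forall x, rnorm (g x) <= C * rnorm x.
  exists (complex.Re `|c| + a) => [|x].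
    by apply: lt_le_trans k0 _; rewrite lerD2l ge0_cp// op_norm_ge0.
  have := rnormD (c *: x) (- f x); rewrite rnormN rnormZ.
  by have := rnorm_le_op_norm bf x; rewrite -/a /g; lra.
(* The lower bound makes preimages of a convergent sequence Cauchy. *)
have clg : seq_closed (range g).
  move=> u y gu uy; have /choice[v vu] : forall n, exists x, g x = u n.
    by move=> n; have [x _ <-] := gu n; exists x.
  have [|x vx] := @rcauchy_cvg _ _ v.
    move=> e e0; have ke : 0 < k * e / 2 by rewrite divr_gt0// mulr_gt0.
    have [N NP] := uy _ ke; exists N => m n Nm Nn.
    rewrite -(ltr_pM2l k0); apply: le_lt_trans (gk _) _.
    rewrite (linear_mapB lg) !vu.
    have := NP m Nm; have := NP n Nn; have := rnormD (u m - y) (y - u n).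
    by rewrite subrKA (rnormB y); lra.
  exists x => //; apply/subr0_eq/rnorm_eq0/eqP; rewrite eq_le rnorm_ge0 andbT.
  apply/ler_addgt0Pr => e e0; rewrite add0r.
  have e20 : 0 < e / 2 by rewrite divr_gt0.
  have eC : 0 < e / 2 / C by rewrite divr_gt0.
  have [N NP] := uy _ e20; have [M MP] := vx _ eC.
  pose n := maxn N M.
  have := NP n (leq_maxl _ _); have := MP n (leq_maxr _ _).
  rewrite ltr_pdivlMr// mulrC => /(le_lt_trans (gC _)).
  rewrite (linear_mapB lg) vu.
  have := rnormD (g x - u n) (u n - y); rewrite subrKA (rnormB (g x) (u n)).
  lra.
have surj y : exists x, g x = y.
  have [_ [x _ <-] orth] := orthogonal_decomposition y (range_subspace lg) clg.
  exists x; apply/esym/subr0_eq; move: (y - g x) orth => r orth.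
  (* A vector orthogonal to the range of [g] satisfies the eigenvalue equation for the conjugate of
     [c], whose modulus is too large unless [r = 0]. *)
  have fr : f r = c^* *: r.
    apply/esym/subr0_eq/inner_nondegenerate => z.
    rewrite innerBl linearZl_LR /= hf.
    have := orth (g z) (imageT g z).
    by rewrite /g innerBr linearZr_LR.
  have := rnorm_le_op_norm bf r; rewrite -/a fr rnormZ.
  have -> : complex.Re `|c^*| = complex.Re `|c| by rewrite norm_conjC.
  move=> h; apply: rnorm_eq0; have := rnorm_ge0 r.
  by rewrite /k in k0; nra.
have [h hK] := choice surj.
have ginj : injective g.
  move=> x y /eqP; rewrite -subr_eq0 -(linear_mapB lg) => /eqP gxy.
  apply/subr0_eq/rnorm_eq0; have := gk (x - y); rewrite gxy rnorm0.
  have := rnorm_ge0 (x - y); nra.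
have lh : linear h by move=> d x y; apply: ginj; rewrite lg !hK.
exists h; split=> //; last by move=> x; apply: ginj; rewrite -/(g _) hK.
split=> //; apply/(continuous_rbounded lh); exists k^-1 => [|x].
  by rewrite invr_gt0.
by rewrite -(ler_pM2l k0) mulVKf ?gt_eqF// -{2}(hK x).
Qed.

(* Outside the spectrum both [a - f] and [- a - f] are bounded below, hence so
   is [a ^ 2 - f ^ 2]; but [norm ((a ^ 2 - f ^ 2) x) ^ 2] is at most
   [a ^ 2 * ((a * norm x) ^ 2 - norm (f x) ^ 2)], which forces [norm (f x)]
   to be at most [c * norm x] for some [c < a]. *)
Lemma op_norm_spectrum : 0 < a -> spectrum f a%:C \/ spectrum f (- a)%:C.
Proof.
move=> a0; apply: contrapT => /not_orP[/contrapT[g1 [bg1 g1K _]]].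
move=> /contrapT[g2 [bg2 g2K _]].
have [C C0 gC] := (continuous_rbounded bg1.1).1 bg1.2.
have [D D0 gD] := (continuous_rbounded bg2.1).1 bg2.2.
have CD0 : 0 < C * D by rewrite mulr_gt0.
have below x : rnorm x <= C * D * rnorm ((a ^+ 2)%:C *: x - f (f x)).
  rewrite -mulrA -{1}(g1K x); apply: le_trans (gC _) _; rewrite ler_pM2l//.
  rewrite -{1}(g2K (_ - _)); apply: le_trans (gD _) _; rewrite ler_pM2l//.
  rewrite rmorphN /= scaleNr -opprD rnormN (linear_mapB lf) (linear_mapZ lf).
  by rewrite scalerBr scalerA -rmorphM -expr2 addrA subrK.
(* Combining [sw], [ws] and [st] below and dividing by [s] yields [s <= M * (a * s - t)] with
   exactly this constant. *)
pose M : R := 2 * (C * D) ^+ 2 * a ^+ 3.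
have M0 : 0 < M by rewrite !mulr_gt0 ?exprn_gt0.
have gap x : rnorm (f x) <= (a - M^-1) * rnorm x.
  have [->|/rnorm_gt0] := pselect (x = 0).
    by rewrite (linear_map0 lf) rnorm0 mulr0.
  set s := rnorm x => s0; set t := rnorm (f x).
  have t0 : 0 <= t := rnorm_ge0 _.
  have ts : t <= a * s := rnorm_le_op_norm bf x.
  have fft : rnorm (f (f x)) ^+ 2 <= (a * t) ^+ 2.
    rewrite ler_sqr ?nnegrE ?(mulr_ge0 (ltW a0)) ?rnorm_ge0//.
    exact: rnorm_le_op_norm.
  have ws : rnorm ((a ^+ 2)%:C *: x - f (f x)) ^+ 2 <=
      a ^+ 2 * ((a * s - t) * (a * s + t)).
    rewrite rnormBE rdotZl -hermitian_rdot// rdotxx rnormZr exprMn.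
    by rewrite real_normK ?num_real// -/s -/t; lra.
  have sw : s ^+ 2 <= (C * D) ^+ 2 *
      rnorm ((a ^+ 2)%:C *: x - f (f x)) ^+ 2.
    have CDw := mulr_ge0 (ltW CD0) (rnorm_ge0 ((a ^+ 2)%:C *: x - f (f x))).
    by rewrite -exprMn ler_sqr ?nnegrE ?(ltW s0)//; exact: below.
  have K0 : 0 < (C * D) ^+ 2 by rewrite exprn_gt0.
  have a20 : 0 < a ^+ 2 by rewrite exprn_gt0.
  have st : (a * s - t) * (a * s + t) <= (a * s - t) * (2 * a * s).
    by rewrite ler_wpM2l// ?subr_ge0//; lra.
  have sM : s <= M * (a * s - t).
    rewrite -(ler_pM2l s0) -expr2; apply: le_trans sw _.
    apply: le_trans (ler_wpM2l (ltW K0) ws) _.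
    apply: le_trans (ler_wpM2l (ltW K0) (ler_wpM2l (ltW a20) st)) _.
    by rewrite le_eqVlt; apply/orP; left; apply/eqP; rewrite /M; ring.
  rewrite -(ler_pM2l M0) mulrA mulrBr divff ?gt_eqF//; lra.
(* The maximum with 0 supplies the nonnegative bound that [op_norm_le] requires; both of its
   arguments are below [a]. *)
have : a <= Num.max 0 (a - M^-1).
  apply: op_norm_le => // [|x]; first by rewrite le_max lexx.
  apply: le_trans (gap x) _; rewrite ler_wpM2r ?rnorm_ge0//.
  by rewrite le_max lexx orbT.
by rewrite le_max leNgt a0 /= leNgt gtrBl invr_gt0 M0.
Qed.

(** Comparing with 1 is enough for the splittings. If [1 <= a], then [a] is positive and
    [op_norm_spectrum] provides a spectral point of modulus [a]; otherwise every spectral point has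
    modulus at most [a < 1]. *)
Theorem spectral_radius_lt1 : spectral_radius f < 1 <-> op_norm f < 1.
Proof.
have ubs : ubound [set complex.Re `|l| | l in spectrum f] a.
  by move=> _ [c sc <-]; exact: spectrum_norm_le.
rewrite /spectral_radius; split=> [r1|a1].
  rewrite ltNge; apply/negP => a1.
  suff : a <= sup [set complex.Re `|l| | l in spectrum f].
    by rewrite leNgt (lt_le_trans r1 a1).
  have a0 : 0 < a := lt_le_trans ltr01 a1.
  apply: ub_le_sup; first by exists a.
  have [sa|sa] := op_norm_spectrum a0; first exists a%:C => //.
    by rewrite Re_norm_real ger0_norm// ltW.
  by exists (- a)%:C => //; rewrite Re_norm_real normrN ger0_norm// ltW.
(* An empty spectrum, as on the zero space, gives the default supremum 0. *)
have [->|/set0P s0] := eqVneq [set complex.Re `|l| | l in spectrum f] set0.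
  by rewrite sup0.
by apply: le_lt_trans a1; exact: ge_sup.
Qed.

End Resolvent.
End SpectralRadius.

(** * The two proper splittings and their convergence *)

Lemma hermitian_proper_splitting (R : realType) (H : hilbertType R)
    (T U : H -> H) :
    bounded_op T -> hermitian_op T -> linear U -> hermitian_op U ->
    range U = range T -> null_space U = null_space T ->
  proper_splitting T U (U \- T).
Proof.
move=> [lT _] hT lU hU rUT nUT; split=> //; first exact: hermitian_bounded_op.
  apply: hermitian_bounded_op; first exact: linear_sub_fun.
  exact: hermitian_sub_fun.
by apply/funext => x /=; rewrite opprB addrC subrK.
Qed.

Theorem proposition6p4 (R : realType) (H : hilbertType R) (T : H -> H)
    (T_bounded : bounded_op T) (T_hermitian : hermitian_op T)
    (T_closed_range : closed (range T)) :
  let W := mp_inverse T \- T in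
  let Z := range_proj T \- T in
  (proper_splitting T (mp_inverse T) W /\
   (converges (mp_inverse T) W <-> op_norm (range_proj T \- (T \o T)) < 1)) /\
  (proper_splitting T (range_proj T) Z /\
   (converges (range_proj T) Z <-> op_norm (range_proj T \- T) < 1)).
Proof.
have [lT _] := T_bounded; have cT := closed_seq_closed T_closed_range.
have lP := range_proj_linear lT cT; have hP := range_proj_hermitian lT cT.
have [X [lX hX rX TX XT]] := mp_inverse_exists lT T_hermitian cT.
have PT := range_projl lT cT; have TP := range_projr lT T_hermitian cT.
have PP := range_proj_idem lT cT.
set P := range_proj T in lP hP TX XT PT TP PP *.
have PX x : P (X x) = X x.
  by have [w _ <-] := rX _ (imageT X x); exact: PT.
have XP x : X (P x) = X x by rewrite -TX XT PX.
have mpT : is_mp_inverse T X.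
  have TXE : T \o X = P by exact/funext.
  have XTE : X \o T = P by exact/funext.
  by split; rewrite ?TXE ?XTE//; apply/funext => x /=; rewrite ?TX ?XT.
(* A Hermitian idempotent is its own Moore-Penrose inverse. *)
have mpP : is_mp_inverse P P.
  have PPE : P \o P = P by exact/funext.
  by split; rewrite ?PPE.
have -> : mp_inverse T = X.
  by apply: mp_inverse_eq => //; exact: hermitian_bounded_op.
move=> /=; split; split.
- apply: hermitian_proper_splitting => //.
    apply/seteqP; split=> // _ [x _ <-].
    (* [T x] is in the range of [X] because [X (T (T x)) = P (T x) = T x]. *)
    by exists (T (T x)) => //; rewrite XT PT.
  apply/seteqP; split=> x /=; rewrite /null_space /= => x0.
    by rewrite -TP -TX x0 !(linear_map0 lT).
  by rewrite -XP -XT x0 !(linear_map0 lX).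
(* The Penrose equations are symmetric, so the Moore-Penrose inverse of [X] is [T] itself. *)
- rewrite /converges (mp_inverse_eq T_bounded (mp_inverse_sym mpT)).
  have -> : T \o (X \- T) = P \- (T \o T).
    by apply/funext => x /=; rewrite (linear_mapB lT) TX.
  have lPTT : linear (P \- (T \o T)).
    by apply: linear_sub_fun => //; exact: linear_comp_fun.
  have hPTT : hermitian_op (P \- (T \o T)).
    by apply: hermitian_sub_fun => // x y /=; rewrite !T_hermitian.
  exact: spectral_radius_lt1 (hermitian_bounded_op lPTT hPTT) hPTT.
- apply: hermitian_proper_splitting => //; apply/seteqP.
    split=> _ [x _ <-]; first by rewrite -TX; exists (X x).
    by rewrite -PT; exists (T x).
  split=> x /=; rewrite /null_space /= => x0.
    by rewrite -TP x0 !(linear_map0 lT).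
  by rewrite -XT x0 !(linear_map0 lX).
- rewrite /converges (mp_inverse_eq (hermitian_bounded_op lP hP) mpP).
  have -> : P \o (P \- T) = P \- T.
    by apply/funext => x /=; rewrite (linear_mapB lP) PP PT.
  have hPT : hermitian_op (P \- T) by exact: hermitian_sub_fun.
  apply: spectral_radius_lt1 => //; apply: hermitian_bounded_op => //.
  exact: linear_sub_fun.
Qed.
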